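(* Let $G$ be a group, let $S$ be a ring which is epsilon-strongly graded by $G$, and put $R=S_e$. Then $S$ is an epsilon-crossed product by $G$ if and only if $S$ is a unital partial crossed product of $G$ over $R$.
   Context: Rings are associative with a nonzero multiplicative identity $1$, except that ideals $D_g$ below are viewed as rings whose identity may be $0$. For additive subgroups $X,Y\subseteq S$, $XY$ denotes the set of finite sums of products $xy$ with $x\in X$, $y\in Y$. Let $e$ be the identity of $G$. Epsilon-strong grading: $S$ is graded by $G$ if there are additive subgroups $S_g\subseteq S$ with $S=\bigoplus_{g\in G}S_g$ and $S_gS_h\subseteq S_{gh}$ for all $g,h\in G$. An ideal of $R=S_e$ is called unital if it has its own multiplicative identity element (allowed to be $0$). $S$ is epsilon-strongly graded by $G$ if for each $g\in G$, $S_gS_{g^{-1}}$ is a unital ideal of $R$, and for all $g,h\in G$ the equalities $S_gS_h = S_gS_{g^{-1}}S_{gh} = S_{gh}S_{h^{-1}}S_h$ hold. Then $\epsilon_g$ denotes the multiplicative identity of $S_gS_{g^{-1}}$. Epsilon-crossed product: an element $s\in S_g$ is epsilon-invertible if there is $t\in S_{g^{-1}}$ with $st=\epsilon_g$ and $ts=\epsilon_{g^{-1}}$. $S$ is an epsilon-crossed product by $G$ if for each $g\in G$ there is an epsilon-invertible element in $S_g$. Unital twisted partial action of $G$ on $R$: a triple $\alpha=(\{D_g\}_{g\in G},\{\alpha_g\}_{g\in G},\{w_{g,h}\}_{(g,h)\in G\times G})$ where for each $g$, $D_g$ is a unital ideal of $R$ with (not necessarily nonzero) identity element $1_g$, which is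 central in $R$; $\alpha_g:D_{g^{-1}}\to D_g$ is an isomorphism of rings; and each $w_{g,h}$ is an invertible element of $D_gD_{gh}$ (a ring with identity $1_g1_{gh}$), such that for all $g,h,l\in G$: (P1) $\alpha_e=\mathrm{id}_R$; (P2) $\alpha_g(D_{g^{-1}}D_h)=D_gD_{gh}$; (P3) if $r\in D_{h^{-1}}D_{(gh)^{-1}}$, then $\alpha_g(\alpha_h(r))=w_{g,h}\alpha_{gh}(r)w_{g,h}^{-1}$; (P4) $w_{e,g}=w_{g,e}=1_g$; (P5) if $r\in D_{g^{-1}}D_hD_{hl}$, then $\alpha_g(rw_{h,l})w_{g,hl}=\alpha_g(r)w_{g,h}w_{gh,l}$. Unital partial crossed product: $R\star_\alpha^wG=\bigoplus_{g\in G}D_g\delta_g$, where the $\delta_g$ are formal symbols, with multiplication given by biadditive extension of (P6) $(r\delta_g)(r'\delta_h)=r\alpha_g(r'1_{g^{-1}})w_{g,h}\delta_{gh}$ for $g,h\in G$, $r\in D_g$, $r'\in D_h$. It is $G$-graded with component $D_g\delta_g$ in degree $g$. A $G$-graded ring $S$ with $R=S_e$ is a unital partial crossed product of $G$ over $R$ if there are a unital twisted partial action of $G$ on $R$ and a ring isomorphism $S\to R\star_\alpha^wG$ mapping $S_g$ onto $D_g\delta_g$ for every $g\in G$ and mapping each $r\in R$ to $r\delta_e$. *)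

(* Defs.v *)
From HB Require Import structures.
From mathcomp Require Import all_boot ssralg.
From mathcomp Require Import boolp classical_sets functions.
From mathcomp Require Import finmap monalg.

Set Implicit Arguments.
Unset Strict Implicit.
Unset Printing Implicit Defensive.
Import GRing.Theory.

Local Open Scope classical_set_scope.
Local Open Scope ring_scope.

Reserved Notation "X ** Y" (at level 40, left associativity).

Section Subsets.
Variable R : nzRingType.
Implicit Types (X Y I : set R) (f : R -> R).

Definition additive_subgroup X :=
  X 0 /\ forall x y, X x -> X y -> X (x - y).

Definition set_prod X Y : set R :=
  [set z | exists2 s : seq (R * R),
     (forall p, p \in s -> X p.1 /\ Y p.2) & z = \sum_(p <- s) p.1 * p.2].

Definition ideal I :=
  additive_subgroup I /\ forall a x, I x -> I (a * x) /\ I (x * a).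

Definition identity_of I (u : R) :=
  I u /\ forall x, I x -> u * x = x /\ x * u = x.

Definition unital_ideal I := ideal I /\ exists u, identity_of I u.

Definition ring_isomorphism_on X Y f :=
  [/\ set_bij X Y f,
      forall x y, X x -> X y -> f (x + y) = f x + f y &
      forall x y, X x -> X y -> f (x * y) = f x * f y].

End Subsets.

Notation "X ** Y" := (set_prod X Y) : classical_set_scope.

(* An element of {malg S[G]} is a finitely supported family f : G -> S,
   with f@_g its value at g and msupp f its support. *)
Record grading (G : groupType) (S : nzRingType) := Grading {
  component :> G -> set S;
  component_subgroup : forall g, additive_subgroup (component g);
  component_direct_sum : forall s : S, exists! f : {malg S[G]},
    (forall g, component g f@_g) /\ s = \sum_(g <- msupp f) f@_g;
  component_mul : forall g h,
    component g ** component h `<=` component (g * h)%g }.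

Section PrincipalComponent.
Variables (G : groupType) (S : nzRingType) (A : grading G S).

Lemma component_mulr g h x y : A g x -> A h y -> A (g * h)%g (x * y).
Proof.
move=> Ax Ay; apply: component_mul.
by exists [:: (x, y)]; [move=> p; rewrite inE => /eqP -> | rewrite big_seq1].
Qed.

Lemma component_inj (f f' : {malg S[G]}) :
  (forall g, A g f@_g) -> (forall g, A g f'@_g) ->
  \sum_(g <- msupp f) f@_g = \sum_(g <- msupp f') f'@_g -> f = f'.
Proof.
move=> Af Af' eqff'.
have [u [_ uniq_u]] := component_direct_sum A (\sum_(g <- msupp f) f@_g).
by rewrite -(uniq_u f) // -(uniq_u f').
Qed.

Lemma component_one : A 1%g 1.
Proof.
have [u [[Au def1] _]] := component_direct_sum A 1.
suff uK h x : A h x -> u@_1%g * x = x.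
  suff -> : 1 = u@_1%g by exact: Au.
  rewrite -[RHS]mulr1 {2}def1 mulr_sumr {1}def1.
  by apply: eq_bigr => g _; rewrite (uK g).
move=> Ax.
pose v : {malg S[G]} := \sum_(g <- msupp u) << u@_g * x *g (g * h)%g >>.
have vE g : v@_g = u@_(g * h^-1)%g * x.
  rewrite raddf_sum /=; case: (boolP ((g * h^-1)%g \in msupp u)) => gu.
    rewrite (big_fsetD1 (g * h^-1)%g) //= mcoeffU mulgVK eqxx mulr1n.
    rewrite big1_fset ?addr0 // => k; rewrite !inE => /andP[kg _] _.
    rewrite mcoeffU; case: eqP => // kh.
    by rewrite -kh mulgK eqxx in kg.
  rewrite (mcoeff_outdom gu) mul0r big1_fset // => k ku _.
  rewrite mcoeffU; case: eqP => // kh.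
  by rewrite -kh mulgK ku in gu.
have sum_v : \sum_(g <- msupp v) v@_g = x.
  rewrite -[RHS]mul1r def1 mulr_suml.
  pose E := [fset (g * h)%g | g in msupp u]%fset.
  have sub : (msupp v `<=` E)%fset.
    apply/fsubsetP => g; rewrite -mcoeff_neq0 vE => nz.
    apply/imfsetP; exists (g * h^-1)%g; last by rewrite mulgVK.
    rewrite /= -mcoeff_neq0; apply: contra_neq nz => ->.
    by rewrite mul0r.
  rewrite (big_fset_incl _ sub) /=; last first.
    by move=> g _ gv; exact: mcoeff_outdom.
  rewrite big_imfset /=; last by move=> a b _ _; apply: mulIg.
  by apply: eq_bigr => g _; rewrite vE mulgK.
have A0 g : A g 0 by have [] := component_subgroup A g.
suff vU : v = << x *g h >> by rewrite -(mulgV h) -vE vU mcoeffUU.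
apply: component_inj => [g|g|].
- by rewrite vE -[X in A X _](mulgVK h g); exact: component_mulr.
- by rewrite mcoeffU; case: eqP => // <-.
- rewrite sum_v msuppU; case: eqP => [->|_]; first by rewrite big_seq_fset0.
  by rewrite big_seq_fset1 mcoeffUU.
Qed.

(* R = S_e as a ring in its own right. *)
Definition degree_one : pred S := fun x => `[< A 1%g x >].

Fact degree_one_subring_closed : subring_closed degree_one.
Proof.
split=> [|x y /asboolP Ax /asboolP Ay|x y /asboolP Ax /asboolP Ay]; apply/asboolP.
- exact: component_one.
- by have [_] := component_subgroup A 1%g; apply.
- by rewrite -[1%g]mulg1; exact: component_mulr.
Qed.
HB.instance Definition _ :=
  GRing.isSubringClosed.Build S degree_one degree_one_subring_closed.

Record principal : predArgType :=
  Principal { principal_val : S; _ : principal_val \in degree_one }.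
HB.instance Definition _ := [isSub for principal_val].
HB.instance Definition _ := [Choice of principal by <:].
HB.instance Definition _ := [SubChoice_isSubNzRing of principal by <:].

End PrincipalComponent.

Section Epsilon.
Variables (G : groupType) (S : nzRingType) (A : grading G S).

Definition epsilon_strongly_graded :=
  (forall g, unital_ideal
     ((val : principal A -> S) @^-1` (A g ** A g^-1%g))) /\
  (forall g h,
     A g ** A h = A g ** A g^-1%g ** A (g * h)%g /\
     A g ** A h = A (g * h)%g ** A h^-1%g ** A h).

(* The identity element of S_g S_{g^-1}; meaningful (and unique) only when
   that ideal is unital, an arbitrary value otherwise. *)
Definition epsilon (g : G) : S :=
  xget 0 [set u | identity_of (A g ** A g^-1%g) u].

Lemma epsilonP : epsilon_strongly_graded ->
  forall g, identity_of (A g ** A g^-1%g) (epsilon g).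
Proof.
move=> [unitalA _] g; apply: (@xgetPex S 0).
have [_ [u [Iu idu]]] := unitalA g.
exists (val u); split=> // x Ix.
have A1x : x \in degree_one A.
  by apply/asboolP; rewrite -(mulgV g); exact: component_mul.
have [ux xu] := idu (Principal A1x) Ix.
by split; [exact: (congr1 val ux) | exact: (congr1 val xu)].
Qed.

Definition epsilon_invertible (g : G) (s : S) :=
  A g s /\
  exists t, [/\ A g^-1%g t, s * t = epsilon g & t * s = epsilon g^-1%g].

Definition epsilon_crossed_product :=
  forall g, exists s, epsilon_invertible g s.

End Epsilon.

(* pa_act g is only relevant on pa_dom g^-1, where it is the isomorphism alpha_g
   onto pa_dom g; pa_twistV g h is the inverse of w_{g,h} in the ring
   pa_dom g ** pa_dom (g * h), whose identity is pa_one g * pa_one (g * h). *)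
Record unital_twisted_partial_action (G : groupType) (R : nzRingType) :=
  UnitalTwistedPartialAction {
  pa_dom : G -> set R;
  pa_one : G -> R;
  pa_act : G -> R -> R;
  pa_twist : G -> G -> R;
  pa_twistV : G -> G -> R;
  pa_dom_ideal : forall g, ideal (pa_dom g);
  pa_one_identity : forall g, identity_of (pa_dom g) (pa_one g);
  pa_one_central : forall g r, pa_one g * r = r * pa_one g;
  pa_act_isomorphism : forall g,
    ring_isomorphism_on (pa_dom g^-1%g) (pa_dom g) (pa_act g);
  pa_twist_mem : forall g h, (pa_dom g ** pa_dom (g * h)%g) (pa_twist g h);
  pa_twistV_mem : forall g h, (pa_dom g ** pa_dom (g * h)%g) (pa_twistV g h);
  pa_twistK : forall g h, pa_twist g h * pa_twistV g h = pa_one g * pa_one (g * h)%g;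
  pa_twistVK : forall g h, pa_twistV g h * pa_twist g h = pa_one g * pa_one (g * h)%g;
  pa_act1 : pa_dom 1%g = setT /\ forall r, pa_act 1%g r = r;
  pa_act_dom : forall g h,
    pa_act g @` (pa_dom g^-1%g ** pa_dom h) = pa_dom g ** pa_dom (g * h)%g;
  pa_act_act : forall g h r, (pa_dom h^-1%g ** pa_dom (g * h)^-1%g) r ->
    pa_act g (pa_act h r) = pa_twist g h * pa_act (g * h)%g r * pa_twistV g h;
  pa_twist1 : forall g, pa_twist 1%g g = pa_one g /\ pa_twist g 1%g = pa_one g;
  pa_act_twist : forall g h l r,
    (pa_dom g^-1%g ** pa_dom h ** pa_dom (h * l)%g) r ->
    pa_act g (r * pa_twist h l) * pa_twist g (h * l)%g =
    pa_act g r * pa_twist g h * pa_twist (g * h)%g l }.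

Section PartialCrossedProduct.
Variables (G : groupType) (R : nzRingType).
Variable alpha : unital_twisted_partial_action G R.

(* The ring of formal sums of terms r delta_g, with r in D_g: a subgroup of
   {malg R[G]}, << r *g g >> standing for r delta_g, with the product
   below and the identity << 1 *g 1 >>. *)
Definition crossed_carrier : set {malg R[G]} :=
  [set a | forall g, pa_dom alpha g a@_g].

Definition crossed_mul (a b : {malg R[G]}) : {malg R[G]} :=
  \sum_(g <- msupp a) \sum_(h <- msupp b)
    << a@_g * pa_act alpha g (b@_h * pa_one alpha g^-1%g) * pa_twist alpha g h
       *g (g * h)%g >>.

Definition crossed_isomorphism (S : nzRingType) (phi : S -> {malg R[G]}) :=
  [/\ set_bij setT crossed_carrier phi,
      forall x y, phi (x + y) = phi x + phi y,
      forall x y, phi (x * y) = crossed_mul (phi x) (phi y) &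
      phi 1 = << 1 *g 1%g >>].

End PartialCrossedProduct.

Definition unital_partial_crossed_product (G : groupType) (S : nzRingType)
    (A : grading G S) :=
  exists (alpha : unital_twisted_partial_action G (principal A))
         (phi : S -> {malg (principal A)[G]}),
    [/\ crossed_isomorphism alpha phi,
        forall g, phi @` A g = [set << r *g g >> | r in pa_dom alpha g] &
        forall r : principal A, phi (val r) = << r *g 1%g >>].

(* Main.v *)
Require Import Defs.
From mathcomp Require Import all_boot ssralg.
From mathcomp Require Import boolp classical_sets functions.
From mathcomp Require Import finmap monalg.

Set Implicit Arguments.
Unset Strict Implicit.
Unset Printing Implicit Defensive.
Import GRing.Theory.

Local Open Scope classical_set_scope.
Local Open Scope ring_scope.

(** Write [eps g] for the identity of S_g S_(g^-1) and R for S_e.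

    Suppose that each S_g contains an epsilon-invertible element s_g, with
    inverse t_g in S_(g^-1); take s_e = 1. The homogeneous elements s_g then
    play the role that units play in a classical crossed product, except that
    s_g t_g and t_g s_g are the idempotents [eps g] and [eps g^-1] instead
    of 1. Right multiplication by s_g and by t_g are mutually inverse
    bijections between D_g = S_g S_(g^-1) and S_g, so that every element of S
    is uniquely a finite sum of terms r_g s_g with r_g in D_g. Conjugation
    r |-> s_g r t_g is a ring isomorphism from D_(g^-1) onto D_g, and
    w_(g,h) = s_g s_h t_(gh) measures the failure of s to be multiplicative.
    The axioms (P1) to (P5) and the compatibility of the products are then
    cancellations of s_g against t_g. What makes them work is the slide rule
    [epsilon_slide]: x * eps h = eps (g * h) * x for every x in S_g. The
    idempotent left by a cancellation can be moved through homogeneous factors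
    until it meets one that absorbs it ([epsilon_mull], [epsilon_mulr]). The
    ring isomorphism is the inverse of [delta_sum], the map that replaces the
    formal symbol delta_g by s_g.

    Conversely, in a partial crossed product 1_g is the identity of
    S_g S_(g^-1) and the element x = 1_g delta_g is epsilon-invertible:
    since w_(g,g^-1) and w_(g^-1,g) are invertible, x has a right inverse y
    and a left inverse z in degree g^-1, and z = z 1_g = z x y = 1_(g^-1) y = y. *)

(** * Sets of sums of products *)

Section SetProducts.
Variable R : nzRingType.
Implicit Types (X Y I : set R).

Lemma set_prodM X Y x y : X x -> Y y -> (X ** Y) (x * y).
Proof.
by exists [:: (x, y)]; [move=> p; rewrite inE => /eqP -> | rewrite big_seq1].
Qed.

Lemma set_prod_lid X Y e z :
  (forall x y, X x -> Y y -> e * (x * y) = x * y) -> (X ** Y) z -> e * z = z.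
Proof.
move=> eXY [s sXY ->]; rewrite mulr_sumr; apply: eq_big_seq => p /sXY[].
exact: eXY.
Qed.

Lemma set_prod_rid X Y e z :
  (forall x y, X x -> Y y -> x * y * e = x * y) -> (X ** Y) z -> z * e = z.
Proof.
move=> eXY [s sXY ->]; rewrite mulr_suml; apply: eq_big_seq => p /sXY[].
exact: eXY.
Qed.

Lemma additive_subgroupN X x : additive_subgroup X -> X x -> X (- x).
Proof. by move=> [X0 XB] Xx; rewrite -sub0r; apply: XB. Qed.

Lemma additive_subgroupD X x y : additive_subgroup X -> X x -> X y -> X (x + y).
Proof.
move=> sX Xx Xy; rewrite -[y]opprK; apply: sX.2 => //.
exact: additive_subgroupN.
Qed.

Lemma additive_subgroup_sum (I : eqType) (r : seq I) X (F : I -> R) :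
  additive_subgroup X -> (forall i, i \in r -> X (F i)) -> X (\sum_(i <- r) F i).
Proof.
move=> sX XF; rewrite big_seq.
elim/big_ind: _ => // [|x y]; [by case: sX | exact: additive_subgroupD].
Qed.

Lemma set_prod_ideal X I z : ideal I -> (X ** I) z -> I z.
Proof.
move=> [sI IM] [s sXI ->]; apply: additive_subgroup_sum => // p /sXI[_ Ip].
by have [] := IM p.1 _ Ip.
Qed.

Lemma ideal_set_prod X I z : ideal I -> (I ** X) z -> I z.
Proof.
move=> [sI IM] [s sIX ->]; apply: additive_subgroup_sum => // p /sIX[Ip _].
by have [] := IM p.2 _ Ip.
Qed.

Lemma identity_of_unique I u v : identity_of I u -> identity_of I v -> u = v.
Proof.
move=> [Iu idu] [Iv idv]; have [uv _] := idu _ Iv.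
by have [_ <-] := idv _ Iu.
Qed.

End SetProducts.

(** * The principal component as a ring *)

Section Principal.
Variables (G : groupType) (S : nzRingType) (A : grading G S).

(** A total map avoids carrying degree proofs inside terms; outside degree one
    its value is the default 0. *)
Definition to_principal (x : S) : principal A := insubd (0 : principal A) x.

Lemma to_principalK x : A 1%g x -> principal_val (to_principal x) = x.
Proof. by move=> Ax; rewrite /to_principal insubdK //; apply/asboolP. Qed.

Lemma principal_homogeneous (r : principal A) : A 1%g (principal_val r).
Proof. by case: r => x rx; apply/asboolP. Qed.

Lemma principal_val_inj : injective (@principal_val G S A).
Proof. exact: val_inj. Qed.

Lemma principal_valD (r r' : principal A) :
  principal_val (r + r') = principal_val r + principal_val r'.
Proof. exact: (raddfD (val : principal A -> S)). Qed.

Lemma principal_valM (r r' : principal A) :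
  principal_val (r * r') = principal_val r * principal_val r'.
Proof. exact: (rmorphM (val : principal A -> S)). Qed.

Lemma principal_val_sum (I : Type) (l : seq I) (F : I -> principal A) :
  principal_val (\sum_(i <- l) F i) = \sum_(i <- l) principal_val (F i).
Proof. exact: (raddf_sum (val : principal A -> S)). Qed.

Lemma component_mull1 g x y : A 1%g x -> A g y -> A g (x * y).
Proof. by move=> Ax Ay; rewrite -[g]mul1g; exact: component_mulr. Qed.

Lemma component_mulr1 g x y : A g x -> A 1%g y -> A g (x * y).
Proof. by move=> Ax Ay; rewrite -[g]mulg1; exact: component_mulr. Qed.

Lemma component_mulV g x y : A g x -> A g^-1%g y -> A 1%g (x * y).
Proof. by move=> Ax Ay; rewrite -(mulgV g); exact: component_mulr. Qed.

End Principal.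

(** * The carrier of a partial crossed product *)

Section CrossedProduct.
Variables (G : groupType) (R : nzRingType).
Variable alpha : unital_twisted_partial_action G R.
Implicit Types (g h : G) (r : R) (a b : {malg R[G]}).

Lemma pa_dom_subgroup g : additive_subgroup (pa_dom alpha g).
Proof. by have [] := pa_dom_ideal alpha g. Qed.

Lemma crossed_carrierU g r : pa_dom alpha g r -> crossed_carrier alpha << r *g g >>.
Proof.
move=> Dr h; rewrite /= mcoeffU; case: eqP => [<-//|_].
by have [] := pa_dom_subgroup h.
Qed.

Lemma crossed_carrierD a b : crossed_carrier alpha a ->
  crossed_carrier alpha b -> crossed_carrier alpha (a + b).
Proof.
move=> Da Db g; rewrite mcoeffD.
by apply: additive_subgroupD => //; exact: pa_dom_subgroup.
Qed.

(** The twist w_(g,h) lies in D_g D_(gh), hence in the ideal D_(gh); this alone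
    puts each term of the product in the right component. *)
Lemma crossed_carrier_mul a b : crossed_carrier alpha (crossed_mul alpha a b).
Proof.
move=> k; rewrite raddf_sum /=.
apply: additive_subgroup_sum => [|g _]; first exact: pa_dom_subgroup.
rewrite raddf_sum /=.
apply: additive_subgroup_sum => [|h _]; first exact: pa_dom_subgroup.
apply: crossed_carrierU.
apply: ((pa_dom_ideal alpha (g * h)%g).2 _ _ _).1.
apply: set_prod_ideal (pa_twist_mem alpha g h); exact: pa_dom_ideal.
Qed.

End CrossedProduct.

(** * Calculus with the idempotents of an epsilon-strong grading *)

Section EpsilonCalculus.
Variables (G : groupType) (S : nzRingType) (A : grading G S).
Hypothesis strongA : epsilon_strongly_graded A.
Local Notation eps := (epsilon A).
Local Notation toR := (to_principal A).
Implicit Types (g h : G) (x : S) (r : principal A).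

Lemma epsilon_degree1 g : A 1%g (eps g).
Proof.
have [Aeps _] := epsilonP strongA g.
by rewrite -(mulgV g); exact: component_mul.
Qed.

(** Epsilon-strongness gives S_g = S_g S_e = S_g S_(g^-1) S_g, and the first
    two factors form the ideal whose identity is [eps g]. *)
Lemma epsilon_mull g x : A g x -> eps g * x = x.
Proof.
move=> Ax; have [_ idA] := epsilonP strongA g.
have : (A g ** A 1%g) x.
  by rewrite -[x]mulr1; apply: set_prodM => //; exact: component_one.
rewrite (strongA.2 g 1%g).1; apply: set_prod_lid => u y /idA[+ _] _.
by rewrite mulrA => ->.
Qed.

(** Symmetric to [epsilon_mull], through S_g = S_e S_g = S_g S_(g^-1) S_g. *)
Lemma epsilon_mulr g x : A g x -> x * eps g^-1%g = x.
Proof.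
move=> Ax; have [_ idA] := epsilonP strongA g^-1%g.
have : (A 1%g ** A g) x.
  by rewrite -[x]mul1r; apply: set_prodM => //; exact: component_one.
rewrite (strongA.2 1%g g).2 => -[s sA ->].
rewrite mulr_suml; apply: eq_big_seq => p /sA[[q qA ->] Ap].
rewrite !mulr_suml; apply: eq_big_seq => c /qA[_ Ac].
rewrite -!mulrA; congr (_ * _); rewrite mulrA.
by apply: (idA _ _).2; apply: set_prodM; rewrite ?invgK.
Qed.

(** Both sides equal eps (g * h) * x * eps h. Expanding [eps h] as a sum of
    products a b with a in S_h, each x a lies in S_(gh) and absorbs
    eps (g * h) on the left. Expanding [eps (g * h)] as a sum of products a b
    with b in S_((gh)^-1), each b x lies in S_(h^-1) and absorbs [eps h] on
    the right. *)
Lemma epsilon_slide g h x : A g x -> x * eps h = eps (g * h)%g * x.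
Proof.
move=> Ax; transitivity (eps (g * h)%g * (x * eps h)).
  have [[s sA ->] _] := epsilonP strongA h.
  rewrite !mulr_sumr; apply: eq_big_seq => p /sA[Ap1 Ap2].
  by rewrite !mulrA -[in RHS](mulrA (eps _)) epsilon_mull //; exact: component_mulr.
rewrite mulrA.
have [[s sA ->] _] := epsilonP strongA (g * h)%g.
rewrite !mulr_suml; apply: eq_big_seq => p /sA[Ap1 Ap2].
rewrite -!mulrA; congr (_ * _); rewrite mulrA -[h in eps h]invgK.
apply: epsilon_mulr; rewrite -[(h^-1)%g](mulgVK g) -invgM.
exact: component_mulr.
Qed.

Lemma epsilon_one : eps 1%g = 1.
Proof. by rewrite -[LHS]mulr1 epsilon_mull //; exact: component_one. Qed.

Lemma epsilonC g r : principal_val r * eps g = eps g * principal_val r.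
Proof.
by have := epsilon_slide g (principal_homogeneous r); rewrite mul1g.
Qed.

Definition epsilon_ideal g : set (principal A) :=
  (val : principal A -> S) @^-1` (A g ** A g^-1%g).

(** Since [eps g] is a central idempotent generating D_g, membership in D_g
    becomes an equation; the next lemmas do the same for the products of
    these ideals in the axioms of a partial action. *)
Lemma epsilon_idealP g r : epsilon_ideal g r <->
  eps g * principal_val r = principal_val r.
Proof.
have [Ieps idA] := epsilonP strongA g; split=> [/idA[]//|erK].
have [[_ IM] _] := strongA.1 g.
have -> : r = to_principal A (eps g) * r.
  by apply: principal_val_inj; rewrite principal_valM to_principalK //;
    exact: epsilon_degree1.
apply: (IM _ _ _).2; rewrite /= to_principalK //; exact: epsilon_degree1.
Qed.


Lemma epsilon_ideal_subgroup g : additive_subgroup (epsilon_ideal g).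
Proof. by have [[]] := strongA.1 g. Qed.

Lemma epsilon_ideal_ideal g : ideal (epsilon_ideal g).
Proof. by have [] := strongA.1 g. Qed.

Lemma epsilon_ideal_mul2P g h r : (epsilon_ideal g ** epsilon_ideal h) r <->
  eps g * principal_val r = principal_val r /\
  eps h * principal_val r = principal_val r.
Proof.
split=> [|[gr hr]].
  move=> [s sD ->]; rewrite principal_val_sum !mulr_sumr.
  split; apply: eq_big_seq => p /sD[/epsilon_idealP gp /epsilon_idealP hp].
    by rewrite principal_valM mulrA gp.
  by rewrite principal_valM mulrA -epsilonC -mulrA hp.
have -> : r = to_principal A (eps g) * r.
  by apply: principal_val_inj; rewrite principal_valM to_principalK //;
    exact: epsilon_degree1.
apply: set_prodM; last exact/epsilon_idealP.
rewrite /epsilon_ideal /= to_principalK; last exact: epsilon_degree1.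
by have [] := epsilonP strongA g.
Qed.

Lemma epsilon_ideal_mul3l g h k r :
  (epsilon_ideal g ** epsilon_ideal h ** epsilon_ideal k) r ->
  eps g * principal_val r = principal_val r.
Proof.
move=> [s sD ->]; rewrite principal_val_sum mulr_sumr.
apply: eq_big_seq => p /sD[/epsilon_ideal_mul2P[gp _] _].
by rewrite principal_valM mulrA gp.
Qed.

(** * The twisted partial action given by epsilon-invertible elements *)

Section Action.
Variables (s t : G -> S).
Hypothesis sA : forall g, A g (s g).
Hypothesis tA : forall g, A g^-1%g (t g).
Hypothesis stK : forall g, s g * t g = eps g.
Hypothesis tsK : forall g, t g * s g = eps g^-1%g.
Hypothesis s1 : s 1%g = 1.

Lemma conj_degree1 g x : A 1%g x -> A 1%g (s g * x * t g).
Proof. by move=> Ax; apply: component_mulV (tA g); exact: component_mulr1. Qed.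

Lemma conjV_degree1 g x : A 1%g x -> A 1%g (t g * x * s g).
Proof.
move=> Ax; rewrite -(mulVg g); apply: component_mulr (sA g).
exact: component_mulr1.
Qed.

Lemma t1 : t 1%g = 1.
Proof. by rewrite -[LHS]mulr1 -s1 tsK invg1 epsilon_one. Qed.

Lemma epsilon_mul_s g : eps g * s g = s g. Proof. exact: epsilon_mull. Qed.
Lemma t_mul_epsilon g : t g * eps g = t g.
Proof. by rewrite -[g in eps g]invgK; exact: epsilon_mulr. Qed.

Definition conj_act g r : principal A := toR (s g * principal_val r * t g).
Definition conj_actV g r : principal A := toR (t g * principal_val r * s g).
Definition factor_set g h : principal A := toR (s g * s h * t (g * h)%g).
Definition factor_setV g h : principal A := toR (s (g * h)%g * t h * t g).

Lemma val_conj_act g r :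
  principal_val (conj_act g r) = s g * principal_val r * t g.
Proof.
by apply: to_principalK; apply: conj_degree1; exact: principal_homogeneous.
Qed.

Lemma val_conj_actV g r :
  principal_val (conj_actV g r) = t g * principal_val r * s g.
Proof.
by apply: to_principalK; apply: conjV_degree1; exact: principal_homogeneous.
Qed.

Lemma val_factor_set g h :
  principal_val (factor_set g h) = s g * s h * t (g * h)%g.
Proof.
by apply: to_principalK; apply: component_mulV (tA _); exact: component_mulr.
Qed.

Lemma val_factor_setV g h :
  principal_val (factor_setV g h) = s (g * h)%g * t h * t g.
Proof.
apply: to_principalK; rewrite -mulrA; apply: component_mulV; first exact: sA.
by rewrite invgM; exact: component_mulr.
Qed.

Lemma val_epsilon g : principal_val (toR (eps g)) = eps g.
Proof. by apply: to_principalK; exact: epsilon_degree1. Qed.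

Lemma epsilon_ideal_identity g : identity_of (epsilon_ideal g) (toR (eps g)).
Proof.
split=> [|r /epsilon_idealP gr].
  rewrite /epsilon_ideal /= val_epsilon.
  by have [] := epsilonP strongA g.
by split; apply: principal_val_inj; rewrite principal_valM val_epsilon // epsilonC.
Qed.

Lemma epsilon_central g r : toR (eps g) * r = r * toR (eps g).
Proof. by apply: principal_val_inj; rewrite !principal_valM val_epsilon epsilonC. Qed.

Lemma conj_actK g r : epsilon_ideal g^-1%g r ->
  conj_actV g (conj_act g r) = r.
Proof.
move=> /epsilon_idealP rg; apply: principal_val_inj.
rewrite val_conj_actV val_conj_act !mulrA tsK rg.
by rewrite -mulrA tsK epsilonC.
Qed.

Lemma conj_actVK g r : epsilon_ideal g r ->
  conj_act g (conj_actV g r) = r.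
Proof.
move=> /epsilon_idealP rg; apply: principal_val_inj.
rewrite val_conj_act val_conj_actV !mulrA stK rg.
by rewrite -mulrA stK epsilonC.
Qed.

Lemma conj_act_mem g r : epsilon_ideal g (conj_act g r).
Proof. by apply/epsilon_idealP; rewrite val_conj_act !mulrA epsilon_mul_s. Qed.

Lemma conj_actV_mem g r : epsilon_ideal g^-1%g (conj_actV g r).
Proof.
by apply/epsilon_idealP; rewrite val_conj_actV !mulrA epsilon_mull.
Qed.

Lemma conj_act_isomorphism g :
  ring_isomorphism_on (epsilon_ideal g^-1%g) (epsilon_ideal g) (conj_act g).
Proof.
split; first split.
- by move=> r _; exact: conj_act_mem.
- move=> r r' /set_mem rg /set_mem r'g /(congr1 (conj_actV g)).
  by rewrite !conj_actK.
- move=> r rg; exists (conj_actV g r); first exact: conj_actV_mem.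
  exact: conj_actVK.
- move=> r r' _ _; apply: principal_val_inj; rewrite [RHS]principal_valD !val_conj_act.
  by rewrite principal_valD mulrDr mulrDl.
- move=> r r' _ /epsilon_idealP r'g; apply: principal_val_inj.
  rewrite principal_valM !val_conj_act principal_valM -!mulrA.
  by congr (_ * (_ * _)); rewrite (mulrA (t g)) tsK mulrA r'g.
Qed.

Lemma conj_act_slide g h r : eps (g * h)%g * principal_val (conj_act g r) =
  s g * (eps h * principal_val r) * t g.
Proof. by rewrite val_conj_act !mulrA (epsilon_slide h (sA g)). Qed.

Lemma conj_act_dom g h :
  conj_act g @` (epsilon_ideal g^-1%g ** epsilon_ideal h) =
  epsilon_ideal g ** epsilon_ideal (g * h)%g.
Proof.
apply/seteqP; split=> r.
  move=> [r' /epsilon_ideal_mul2P[_ hr'] <-]; apply/epsilon_ideal_mul2P.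
  split; first exact/epsilon_idealP/conj_act_mem.
  by rewrite conj_act_slide hr' val_conj_act.
move=> /epsilon_ideal_mul2P[gr ghr]; exists (conj_actV g r); last first.
  by apply/conj_actVK/epsilon_idealP.
apply/epsilon_ideal_mul2P; split; first exact/epsilon_idealP/conj_actV_mem.
have := epsilon_slide (g * h)%g (tA g); rewrite mulKg => slide.
by rewrite val_conj_actV !mulrA -slide -(mulrA (t g)) ghr.
Qed.

Lemma factor_set_mem g h :
  (epsilon_ideal g ** epsilon_ideal (g * h)%g) (factor_set g h).
Proof.
apply/epsilon_ideal_mul2P; split; first by rewrite val_factor_set !mulrA epsilon_mul_s.
by rewrite -epsilonC val_factor_set -mulrA t_mul_epsilon.
Qed.

Lemma factor_setV_mem g h :
  (epsilon_ideal g ** epsilon_ideal (g * h)%g) (factor_setV g h).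
Proof.
apply/epsilon_ideal_mul2P; split.
  by rewrite -epsilonC val_factor_setV -mulrA t_mul_epsilon.
by rewrite val_factor_setV !mulrA epsilon_mul_s.
Qed.

Lemma epsilon_slide_t g h : eps (g * h)^-1%g * t h = t h * eps g^-1%g.
Proof. by rewrite (epsilon_slide _ (tA h)) invgM. Qed.

Lemma epsilon_slideV g h x : A h x -> x * eps (g * h)^-1%g = eps g^-1%g * x.
Proof. by move=> Ax; rewrite (epsilon_slide _ Ax) invgM mulVKg. Qed.

Lemma epsilon_comm g h : eps g * eps h = eps h * eps g.
Proof. by rewrite (epsilon_slide h (epsilon_degree1 g)) mul1g. Qed.

(** Cancelling t_(gh) s_(gh) leaves an idempotent that slides past t_h into t_g;
    then s_h t_h leaves [eps h], which slides past s_g and becomes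
    [eps (g * h)]. *)
Lemma factor_setK g h :
  factor_set g h * factor_setV g h = toR (eps g) * toR (eps (g * h)%g).
Proof.
apply: principal_val_inj; rewrite !principal_valM !val_epsilon.
rewrite val_factor_set val_factor_setV -!mulrA (mulrA (t (g * h)%g)) tsK.
rewrite (mulrA _ (t h)) epsilon_slide_t -mulrA epsilon_mull //.
by rewrite (mulrA (s h)) stK mulrA (epsilon_slide _ (sA g)) -mulrA stK epsilon_comm.
Qed.

Lemma factor_setVK g h :
  factor_setV g h * factor_set g h = toR (eps g) * toR (eps (g * h)%g).
Proof.
apply: principal_val_inj; rewrite !principal_valM !val_epsilon.
rewrite val_factor_set val_factor_setV -!mulrA (mulrA (t g)) tsK.
rewrite (mulrA _ (s h)) -(epsilon_slideV g (sA h)) -mulrA (epsilon_mull (tA _)).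
rewrite (mulrA (t h)) tsK mulrA (epsilon_slide _ (sA _)) mulgK -mulrA stK.
by [].
Qed.

Lemma conj_act1 r : conj_act 1%g r = r.
Proof.
by apply: principal_val_inj; rewrite val_conj_act s1 t1 mul1r mulr1.
Qed.

Lemma epsilon_ideal1 : epsilon_ideal 1%g = setT.
Proof.
by apply/seteqP; split=> // r _; apply/epsilon_idealP; rewrite epsilon_one mul1r.
Qed.

Lemma conj_act_act g h r :
  (epsilon_ideal h^-1%g ** epsilon_ideal (g * h)^-1%g) r ->
  conj_act g (conj_act h r) =
  factor_set g h * conj_act (g * h)%g r * factor_setV g h.
Proof.
move=> /epsilon_ideal_mul2P[_ ghr]; apply: principal_val_inj.
rewrite !principal_valM !val_conj_act val_factor_set val_factor_setV.
rewrite -!mulrA !(mulrA (t (g * h)%g)) !tsK !(mulrA (eps _)) ghr.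
by rewrite epsilon_slide_t -!mulrA (epsilon_mull (tA g)).
Qed.

Lemma factor_set1 g :
  factor_set 1%g g = toR (eps g) /\ factor_set g 1%g = toR (eps g).
Proof.
by split; apply: principal_val_inj; rewrite val_factor_set val_epsilon
  ?mul1g ?mulg1 s1 ?mul1r ?mulr1 stK.
Qed.

(** Both sides are s_g r s_h s_l t_(ghl): the idempotents produced by the
    cancellations are absorbed by s_h s_l, or by r, which lies in D_(g^-1). *)
Lemma conj_act_twist g h l r :
  (epsilon_ideal g^-1%g ** epsilon_ideal h ** epsilon_ideal (h * l)%g) r ->
  conj_act g (r * factor_set h l) * factor_set g (h * l)%g =
  conj_act g r * factor_set g h * factor_set (g * h)%g l.
Proof.
move=> /epsilon_ideal_mul3l gr; apply: principal_val_inj.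
have rg : principal_val r * eps g^-1%g = principal_val r by rewrite epsilonC.
transitivity (s g * principal_val r * s h * s l * t (g * h * l)%g).
  have WE : principal_val (r * factor_set h l) =
            principal_val r * (s h * s l * t (h * l)%g).
    by rewrite principal_valM val_factor_set.
  have Wg : principal_val (r * factor_set h l) * eps g^-1%g =
            principal_val (r * factor_set h l).
    by rewrite epsilonC WE mulrA gr.
  move: (r * _) WE Wg => W WE Wg.
  rewrite principal_valM val_conj_act val_factor_set -!mulrA.
  rewrite (mulrA (t g)) tsK (mulrA (principal_val _) (eps _)) Wg mulgA WE.
  rewrite -!mulrA (mulrA (t (h * l)%g)) tsK !mulrA -(mulrA _ (s h) (s l)).
  by rewrite -(mulrA _ _ (eps _)) (epsilon_mulr (component_mulr (sA h) (sA l))).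
rewrite !principal_valM val_conj_act !val_factor_set -!mulrA.
rewrite (mulrA (t g)) tsK (mulrA (t (g * h)%g)) tsK.
rewrite (mulrA (s h) (eps _)) (epsilon_slideV g (sA h)) -!mulrA.
by do 2!rewrite (mulrA (principal_val r) (eps _)) rg.
Qed.

Definition conj_action : unital_twisted_partial_action G (principal A) :=
  UnitalTwistedPartialAction epsilon_ideal_ideal epsilon_ideal_identity
    epsilon_central conj_act_isomorphism factor_set_mem
    factor_setV_mem factor_setK factor_setVK
    (conj epsilon_ideal1 conj_act1) conj_act_dom conj_act_act
    factor_set1 conj_act_twist.

(** * The isomorphism with the crossed product *)

(** The ring map that sends r delta_g to r s_g. *)
Definition delta_sum (a : {malg (principal A)[G]}) : S :=
  \sum_(g <- msupp a) principal_val a@_g * s g.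

(** Summing over any finite set containing the support makes additivity a
    termwise matter. *)
Lemma delta_sumEw a (E : {fset G}) : (msupp a `<=` E)%fset ->
  delta_sum a = \sum_(g <- E) principal_val a@_g * s g.
Proof.
move=> aE; apply: big_fset_incl aE _ => g _ /mcoeff_outdom ->.
by rewrite [principal_val 0](raddf0 (val : principal A -> S)) mul0r.
Qed.

Lemma delta_sumD a b : delta_sum (a + b) = delta_sum a + delta_sum b.
Proof.
rewrite (delta_sumEw (msuppD_le a b)) (delta_sumEw (fsubsetUl _ (msupp b))).
rewrite (delta_sumEw (fsubsetUr (msupp a) _)) -big_split /=.
by apply: eq_bigr => g _; rewrite mcoeffD principal_valD mulrDl.
Qed.

Lemma delta_sumU r g : delta_sum << r *g g >> = principal_val r * s g.
Proof. by rewrite (delta_sumEw msuppU_le) big_seq_fset1 mcoeffUU. Qed.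

Lemma delta_sum_bigsum (I : Type) (l : seq I) (F : I -> {malg (principal A)[G]}) :
  delta_sum (\sum_(i <- l) F i) = \sum_(i <- l) delta_sum (F i).
Proof.
apply: (big_morph _ delta_sumD).
by rewrite /delta_sum msupp0 big_seq_fset0.
Qed.

Lemma delta_sum_mulU g h r r' :
  principal_val (r * conj_act g (r' * toR (eps g^-1%g)) * factor_set g h)
    * s (g * h)%g = principal_val r * s g * (principal_val r' * s h).
Proof.
have absorb x : s g * (principal_val r' * (eps g^-1%g * x)) =
                s g * (principal_val r' * x).
  by rewrite (mulrA (principal_val r')) epsilonC -mulrA mulrA (epsilon_mulr (sA g)).
rewrite !principal_valM val_conj_act val_factor_set principal_valM.
rewrite val_epsilon -!mulrA (mulrA (t g)) tsK tsK.
by rewrite (epsilon_slideV g (sA h)) !absorb.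
Qed.

Lemma delta_sum_mul a b :
  delta_sum (crossed_mul conj_action a b) = delta_sum a * delta_sum b.
Proof.
rewrite delta_sum_bigsum mulr_suml; apply: eq_bigr => g _.
rewrite delta_sum_bigsum mulr_sumr; apply: eq_bigr => h _.
by rewrite delta_sumU delta_sum_mulU.
Qed.

Lemma delta_term_mem g r : A g (principal_val r * s g).
Proof. exact: component_mull1 (principal_homogeneous r) (sA g). Qed.

(** The terms r_g s_g are determined by the grading, and r_g = (r_g s_g) t_g
    because r_g lies in D_g. *)
Lemma delta_sum_inj a b : crossed_carrier conj_action a ->
  crossed_carrier conj_action b -> delta_sum a = delta_sum b -> a = b.
Proof.
pose f (c : {malg (principal A)[G]}) : {malg S[G]} :=
  [malg g in msupp c => principal_val c@_g * s g].
have fE c g : (f c)@_g = principal_val c@_g * s g.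
  rewrite mcoeffE; case: msuppP => //.
  by rewrite [principal_val 0](raddf0 (val : principal A -> S)) mul0r.
have sum_f c : delta_sum c = \sum_(g <- msupp (f c)) (f c)@_g.
  rewrite [RHS](@big_fset_incl _ _ _ _ _ (msupp c)); last first.
  - by move=> g _ /mcoeff_outdom.
  - apply/fsubsetP => g; apply: contraLR => gc.
    by rewrite -mcoeff_eq0 mcoeffE (negbTE gc).
  by apply: eq_bigr => g _; rewrite fE.
move=> Da Db; rewrite !sum_f => eqab.
have {}eqab : f a = f b.
  by apply: component_inj eqab => g; rewrite fE; exact: delta_term_mem.
apply/malgP => g; apply: principal_val_inj.
have valE c : crossed_carrier conj_action c ->
    principal_val c@_g = (f c)@_g * t g.
  move=> /(_ g)/epsilon_idealP cg.
  by rewrite fE -mulrA stK epsilonC.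
by rewrite !valE // eqab.
Qed.

(** A homogeneous x in S_g is (x t_g) s_g, as s_g and t_g cancel to
    [eps g^-1], which x absorbs. *)
Lemma delta_sum_surj x :
  exists2 a, crossed_carrier conj_action a & delta_sum a = x.
Proof.
have [f [[Af ->] _]] := component_direct_sum A x.
have ftA g : A 1%g (f@_g * t g) by exact: component_mulV.
pose a : {malg (principal A)[G]} := [malg g in msupp f => toR (f@_g * t g)].
exists a => [g|].
  rewrite /= mcoeffE; case: ifP => _; last by case: (epsilon_ideal_subgroup g).
  apply/epsilon_idealP; rewrite [principal_val _]to_principalK //.
  by rewrite mulrA epsilon_mull.
rewrite (@delta_sumEw _ (msupp f)).
  apply: eq_big_seq => g gf.
  rewrite mcoeffE gf [principal_val _]to_principalK // -mulrA tsK.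
  exact: epsilon_mulr.
by apply/fsubsetP => g; apply: contraLR => gf; rewrite -mcoeff_eq0 mcoeffE (negbTE gf).
Qed.

End Action.

(** The choice s_e = 1, possible because [eps 1] = 1, is what normalizes the
    action and the twist: it gives (P1) and (P4), and sends r delta_e to r. *)
Lemma epsilon_invertible_choice : epsilon_crossed_product A ->
  exists s t : G -> S,
    [/\ forall g, A g (s g), forall g, A g^-1%g (t g),
        forall g, s g * t g = eps g, forall g, t g * s g = eps g^-1%g &
        s 1%g = 1].
Proof.
move=> crossedA.
have /choice[p pP] : forall g, exists p : S * S,
    [/\ A g p.1, A g^-1%g p.2, p.1 * p.2 = eps g, p.2 * p.1 = eps g^-1%g &
        g = 1%g -> p.1 = 1].
  move=> g; have [->|g1] := pselect (g = 1%g).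
    by exists (1, 1); rewrite invg1 mulr1 epsilon_one; split=> //;
      exact: component_one.
  by have [x [Ax [y [Ay xy yx]]]] := crossedA g; exists (x, y).
exists (fst \o p), (snd \o p); split=> [g|g|g|g|] /=; try by case: (pP g).
by have [_ _ _ _ ->] := pP 1%g.
Qed.

Lemma epsilon_crossed_partial_crossed :
  epsilon_crossed_product A -> unital_partial_crossed_product A.
Proof.
move=> /epsilon_invertible_choice[s [t [sA tA stK tsK s1]]].
pose alpha := conj_action sA tA stK tsK s1.
pose phi x := xget 0 [set a | crossed_carrier alpha a /\ delta_sum s a = x].
have phiP x : crossed_carrier alpha (phi x) /\ delta_sum s (phi x) = x.
  have [a Da ax] := delta_sum_surj sA tA stK tsK s1 x.
  have ex : exists a, [set a | crossed_carrier alpha a /\ delta_sum s a = x] a.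
    by exists a.
  exact: xgetPex ex.
have phiD x := (phiP x).1; have phiK x := (phiP x).2.
have phi_uniq a x : crossed_carrier alpha a -> delta_sum s a = x -> phi x = a.
  by move=> Da ax; apply: (delta_sum_inj (phiD x) Da); rewrite phiK.
have phiU g x : A g x -> phi x = << toR (x * t g) *g g >>.
  move=> Ax; have A1 : A 1%g (x * t g) by exact: component_mulV Ax (tA g).
  apply: phi_uniq; last first.
    by rewrite delta_sumU [principal_val _]to_principalK // -mulrA tsK epsilon_mulr.
  apply: crossed_carrierU; apply/epsilon_idealP.
  by rewrite [principal_val _]to_principalK // mulrA epsilon_mull.
exists alpha, phi; split.
- split.
  + split.
    * by move=> x _.
    * by move=> x y _ _ xy; rewrite -[x]phiK xy phiK.
    * by move=> a Da; exists (delta_sum s a) => //; exact: phi_uniq.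
  + move=> x y; apply: phi_uniq; first exact: crossed_carrierD.
    by rewrite delta_sumD !phiK.
  + move=> x y; apply: phi_uniq; first exact: crossed_carrier_mul.
    by rewrite delta_sum_mul !phiK.
  + apply: phi_uniq; last by rewrite delta_sumU s1 mulr1.
    by apply: crossed_carrierU; rewrite /= epsilon_ideal1.
- move=> g; apply/seteqP; split=> a.
    move=> [x Ax <-]; exists (toR (x * t g)); last by rewrite (phiU g).
    apply/epsilon_idealP; rewrite [principal_val _]to_principalK ?mulrA.
      by rewrite epsilon_mull.
    exact: component_mulV Ax (tA g).
  move=> [r Dr <-]; exists (principal_val r * s g).
    exact: component_mull1 (principal_homogeneous r) (sA g).
  by apply: phi_uniq; [exact: crossed_carrierU | rewrite delta_sumU].
- move=> r; apply: phi_uniq; last by rewrite delta_sumU s1 mulr1.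
  by apply: crossed_carrierU; rewrite /= epsilon_ideal1.
Qed.

End EpsilonCalculus.

(** * Epsilon-invertible elements of a partial crossed product *)

Section PartialCrossedEpsilon.
Variables (G : groupType) (S : nzRingType) (A : grading G S).
Variable alpha : unital_twisted_partial_action G (principal A).
Variable phi : S -> {malg (principal A)[G]}.
Hypothesis phi_iso : crossed_isomorphism alpha phi.
Hypothesis phi_graded :
  forall g, phi @` A g = [set << r *g g >> | r in pa_dom alpha g].
Hypothesis phi_val : forall r : principal A, phi (val r) = << r *g 1%g >>.
Local Notation D := (pa_dom alpha).
Local Notation one := (pa_one alpha).
Local Notation act := (pa_act alpha).
Local Notation w := (pa_twist alpha).
Local Notation wV := (pa_twistV alpha).

Lemma crossed_phi_inj : injective phi.
Proof.
by have [[_ phi_inj _] _ _ _] := phi_iso; move=> x y; apply: phi_inj; exact: mem_setT.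
Qed.

Lemma crossed_phiM x y : phi (x * y) = crossed_mul alpha (phi x) (phi y).
Proof. by have [_ _ ->] := phi_iso. Qed.

Lemma component_crossed g x : A g x -> exists2 r, D g r & phi x = << r *g g >>.
Proof.
move=> Ax; have : (phi @` A g) (phi x) by exists x.
by rewrite phi_graded => -[r Dr <-]; exists r.
Qed.

Lemma crossed_component g r : D g r -> exists2 x, A g x & phi x = << r *g g >>.
Proof.
move=> Dr; suff : (phi @` A g) << r *g g >> by [].
by rewrite phi_graded; exists r.
Qed.

Lemma pa_one_mem g : D g (one g). Proof. by have [] := pa_one_identity alpha g. Qed.
Lemma pa_one_mull g r : D g r -> one g * r = r.
Proof. by have [_ id1] := pa_one_identity alpha g; move=> /id1[]. Qed.
Lemma pa_one_mulr g r : D g r -> r * one g = r.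
Proof. by have [_ id1] := pa_one_identity alpha g; move=> /id1[]. Qed.

Lemma pa_act0 g : act g 0 = 0.
Proof.
have [_ actD _] := pa_act_isomorphism alpha g.
have D0 : D g^-1%g 0 by have [[]] := pa_dom_ideal alpha g^-1%g.
by apply: (addrI (act g 0)); rewrite -actD // !addr0.
Qed.

(** [crossed_mul] sums over supports, which are empty when r or r' vanishes;
    the formula persists because [pa_act] preserves 0. *)
Lemma crossed_mulUU g h r r' : crossed_mul alpha << r *g g >> << r' *g h >> =
  << r * act g (r' * one g^-1%g) * w g h *g (g * h)%g >>.
Proof.
rewrite /crossed_mul (big_fset_incl _ msuppU_le) /=
  => [|k _ /mcoeff_outdom ->]; last first.
  by rewrite big1_fset // => h' _ _; rewrite !mul0r monalgU0.
rewrite big_seq_fset1 (big_fset_incl _ msuppU_le) /=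
  => [|k _ /mcoeff_outdom ->]; last first.
  by rewrite mul0r pa_act0 mulr0 mul0r monalgU0.
by rewrite big_seq_fset1 !mcoeffUU.
Qed.

Lemma pa_act_one g : act g (one g^-1%g) = one g.
Proof.
have [[actD _ act_surj] _ actM] := pa_act_isomorphism alpha g.
apply: (identity_of_unique _ (pa_one_identity alpha g)).
split=> [|_ /act_surj[r Dr <-]]; first exact/actD/pa_one_mem.
by rewrite -!actM ?pa_one_mull ?pa_one_mulr //; exact: pa_one_mem.
Qed.

Lemma pa_one1 : one 1%g = 1.
Proof.
by rewrite -[LHS]mulr1 pa_one_mull // (pa_act1 alpha).1.
Qed.

Lemma crossed_one_mull g x : A g x -> val (one g) * x = x.
Proof.
move=> /component_crossed[r Dr xr]; apply: crossed_phi_inj.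
rewrite crossed_phiM phi_val xr crossed_mulUU mul1g (pa_act1 alpha).2.
by rewrite (pa_twist1 alpha g).1 invg1 pa_one1 mulr1 pa_one_mull // pa_one_mulr.
Qed.

Lemma crossed_one_mulr g x : A g x -> x * val (one g^-1%g) = x.
Proof.
move=> /component_crossed[r Dr xr]; apply: crossed_phi_inj.
rewrite crossed_phiM phi_val xr crossed_mulUU mulg1 pa_one_mull; last exact: pa_one_mem.
by rewrite pa_act_one (pa_twist1 alpha g).2 !pa_one_mulr.
Qed.

(** For x = 1_g delta_g, a right inverse is r delta_(g^-1) with alpha_g(r) the
    inverse of w_(g,g^-1), and a left inverse is w_(g^-1,g)^-1 delta_(g^-1).
    They agree by the usual argument, with 1_g and 1_(g^-1) for identities. *)
Lemma crossed_unit_exists g : exists x y,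
  [/\ A g x, A g^-1%g y, x * y = val (one g) & y * x = val (one g^-1%g)].
Proof.
have [x Ax xE] := crossed_component (pa_one_mem g).
have wVD k h : D k (wV k h).
  by apply: ideal_set_prod (pa_twistV_mem alpha k h); exact: pa_dom_ideal.
have [y Ay xy] : exists2 y, A g^-1%g y & x * y = val (one g).
  have [[_ _ act_surj] _ _] := pa_act_isomorphism alpha g.
  have [r Dr actr] := act_surj _ (wVD g g^-1%g).
  have [y Ay yE] := crossed_component Dr.
  exists y => //; apply: crossed_phi_inj.
  rewrite crossed_phiM phi_val xE yE crossed_mulUU pa_one_mulr // actr.
  by rewrite pa_one_mull // pa_twistVK mulgV pa_one1 mulr1.
have [z Az zx] : exists2 z, A g^-1%g z & z * x = val (one g^-1%g).
  have [z Az zE] := crossed_component (wVD g^-1%g g).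
  exists z => //; apply: crossed_phi_inj.
  rewrite crossed_phiM phi_val xE zE crossed_mulUU invgK pa_one_mulr;
    last exact: pa_one_mem.
  have := pa_act_one g^-1%g; rewrite invgK => ->.
  by rewrite pa_one_mulr // pa_twistVK mulVg pa_one1 mulr1.
exists x, y; split=> //; suff <- : z = y by [].
have := crossed_one_mulr Az; rewrite invgK => <-.
by rewrite -xy mulrA zx crossed_one_mull.
Qed.

Lemma epsilon_crossed_one g : epsilon A g = val (one g).
Proof.
have idg : identity_of (A g ** A g^-1%g) (val (one g)).
  split=> [|u Au].
    have [x [y [Ax Ay <- _]]] := crossed_unit_exists g; exact: set_prodM.
  split.
    by apply: set_prod_lid Au => x y Ax _; rewrite mulrA crossed_one_mull.
  apply: set_prod_rid Au => x y _ Ay; rewrite -mulrA; congr (_ * _).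
  by rewrite -[g in one g]invgK crossed_one_mulr.
have ex : exists u, [set u | identity_of (A g ** A g^-1%g) u] u.
  by exists (val (one g)).
exact: identity_of_unique (xgetPex 0 ex) idg.
Qed.

Lemma partial_crossed_epsilon_crossed : epsilon_crossed_product A.
Proof.
move=> g; have [x [y [Ax Ay xy yx]]] := crossed_unit_exists g.
by exists x; split=> //; exists y; rewrite !epsilon_crossed_one.
Qed.

End PartialCrossedEpsilon.

Theorem theorem33 (G : groupType) (S : nzRingType) (A : grading G S) :
  epsilon_strongly_graded A ->
  (epsilon_crossed_product A <-> unital_partial_crossed_product A).
Proof.
move=> strongA; split; first exact: epsilon_crossed_partial_crossed.
move=> [alpha [phi [phi_iso phi_graded phi_val]]].
exact: partial_crossed_epsilon_crossed phi_iso phi_graded phi_val.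
Qed.
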